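(* Let $\Gamma$ be the path on $K$ vertices. Given $\lambda>1$, $K=\omega(\sqrt n)$ and $K=o(n)$, for a realization $G$ of the graph under $\mathbb{P}_1$, every estimator $\hat{\mathcal K}$ of the planted node set achieves negligible overlap: $\mathrm{ov}(\hat{\mathcal K})=o(K)$.
   Context: Model: $n$ nodes; $\lambda>0$ fixed. $\mathbb{P}_1$: $G=G_0\cup G'$ with $G_0\sim\mathcal G(n,\lambda/n)$ and $G'$ the image of the path $1-2-\cdots-K$ under an injection $\sigma:[K]\to[n]$ chosen uniformly at random independently of $G_0$; $\mathcal K=\sigma([K])$. An estimator is a set $\hat{\mathcal K}$ of $K$ nodes computed from $G$; $\mathrm{ov}(\hat{\mathcal K})=\sum_{i\in[n]}\mathbb{P}_1(i\in\hat{\mathcal K}\cap\mathcal K)$. Asymptotics as $n\to\infty$. *)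

(* Defs.v *)
From HB Require Import structures.
From mathcomp Require Import all_boot all_order all_algebra.
From mathcomp Require Import all_classical all_reals all_analysis.
Set Implicit Arguments. Unset Strict Implicit. Unset Printing Implicit Defensive.
Import Order.TTheory GRing.Theory Num.Theory.
Local Open Scope ring_scope.

(* A simple graph on node set 'I_n is a set of edges (i,j) with i < j. *)
Definition graph (n : nat) := {set 'I_n * 'I_n}.

Definition upair (n : nat) (i j : 'I_n) : 'I_n * 'I_n :=
  if (i < j)%N then (i, j) else (j, i).

Definition injs (n K : nat) : {set {ffun 'I_K -> 'I_n}} :=
  [set s : {ffun 'I_K -> 'I_n} | injectiveb s].

Definition path_edges (n K : nat) (s : {ffun 'I_K -> 'I_n}) : graph n :=
  [set upair (s ij.1) (s ij.2) |
     ij in [set ij : 'I_K * 'I_K | nat_of_ord ij.2 == (nat_of_ord ij.1).+1]].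

Definition planted (n K : nat) (s : {ffun 'I_K -> 'I_n}) : {set 'I_n} :=
  [set s k | k in [set: 'I_K]].

Definition ER_prob (R : realType) (n : nat) (p : R) (G : graph n) : R :=
  if G \subset [set e : 'I_n * 'I_n | (nat_of_ord e.1 < nat_of_ord e.2)%N] then
    \prod_(e : 'I_n * 'I_n | (nat_of_ord e.1 < nat_of_ord e.2)%N)
       (if e \in G then p else 1 - p)
  else 0.

(* Edge probability lambda/n (capped at 1, which is irrelevant for n >= lambda). *)
Definition edge_p (R : realType) (lam : R) (n : nat) : R := Num.min 1 (lam / n%:R).

(* ov(Khat) = sum_i P_1(i \in Khat(G) \cap planted set), where under P_1,
   G0 ~ G(n, lam/n) and sigma uniform over injections, independently,
   and G = G0 \cup G'. *)
Definition overlap (R : realType) (lam : R) (n K : nat)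
    (Khat : graph n -> {set 'I_n}) : R :=
  \sum_(i : 'I_n) \sum_(s in injs n K) \sum_(G0 : graph n)
     (ER_prob (edge_p lam n) G0 / (#|injs n K|)%:R) *
     ((i \in Khat (G0 :|: path_edges s)) && (i \in planted s))%:R.

(* Main.v *)
Require Import Defs.
From HB Require Import structures.
From mathcomp Require Import all_boot all_order all_algebra.
From mathcomp Require Import all_classical all_reals all_analysis.
From mathcomp Require Import zify ring lra.
Set Implicit Arguments. Unset Strict Implicit. Unset Printing Implicit Defensive.
Import Order.TTheory GRing.Theory Num.Theory.
Local Open Scope ring_scope.

(** Fix a position k of the path, far from its ends, and reveal to the estimator
    the whole path except the L vertices on either side of k, where L is a large
    multiple of log n.  Compare the planted law of (G, sigma(k)) with the law in
    which the 2(L+1) hidden edges are not planted and v = sigma(k) is a fresh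
    uniform vertex: the latter is independent of G, so v falls in the estimated
    set with probability at most K/(n-K) = o(1).  The density of the former law
    with respect to the latter is the normalised number of paths of length 2(L+1)
    in G joining the two ends of the hidden segment through v.  Its second
    moment is the mean of p^(-s), where s counts the edges shared by two
    independent such paths.  Writing N for the number of available vertices and
    1/(pN) <= r < 1 (this is lambda > 1 and K = o(n)), a run of i shared edges
    attached to one end costs r^i, a run attached to neither end costs
    O(L r^i / N), and a run joining two fixed vertices costs N r^(L+1) <= 1; the
    second moment is therefore bounded, and sigma(k) is in the estimated set with
    probability o(1), uniformly in k.  The O(log n) positions near the ends are
    negligible because K is at least of order sqrt n. *)

(** * Sums over sequences of vertices *)

Section SumSeq.
Variables (R : numDomainType) (T : finType).
Implicit Types (Om : {set T}) (phi psi : seq T -> R).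

(** Summing one entry at a time makes the first-step recursions for walks hold by computation. *)
Fixpoint sumseq Om (j : nat) phi : R :=
  if j is j'.+1 then \sum_(x in Om) sumseq Om j' (fun l => phi (x :: l))
  else phi [::].

Lemma le_sumseq Om j phi psi :
  (forall l, size l = j -> {subset l <= Om} -> phi l <= psi l) ->
  sumseq Om j phi <= sumseq Om j psi.
Proof.
elim: j phi psi => [|j IH] phi psi H /=; first exact: H.
apply: ler_sum => x xO; apply: IH => l sl lO; apply: H => /=; first by rewrite sl.
by move=> z; rewrite inE => /orP[/eqP->//|/lO].
Qed.

Lemma eq_sumseq Om j phi psi :
  (forall l, size l = j -> {subset l <= Om} -> phi l = psi l) ->
  sumseq Om j phi = sumseq Om j psi.
Proof. by move=> H; apply/le_anti/andP; split; apply: le_sumseq => l sl lO; rewrite H. Qed.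

Lemma sumseq_ge0 Om j phi :
  (forall l, size l = j -> {subset l <= Om} -> 0 <= phi l) -> 0 <= sumseq Om j phi.
Proof.
elim: j phi => [|j IH] phi H /=; first exact: H.
apply: sumr_ge0 => x xO; apply: IH => l sl lO; apply: H => /=; first by rewrite sl.
by move=> z; rewrite inE => /orP[/eqP->//|/lO].
Qed.

Lemma sumseqD Om j phi psi :
  sumseq Om j (fun l => phi l + psi l) = sumseq Om j phi + sumseq Om j psi.
Proof.
elim: j phi psi => //= j IH phi psi; rewrite -big_split.
by apply: eq_bigr => x _; rewrite IH.
Qed.

Lemma sumseqZ Om j c phi :
  sumseq Om j (fun l => c * phi l) = c * sumseq Om j phi.
Proof.
elim: j phi => //= j IH phi; rewrite mulr_sumr.
by apply: eq_bigr => x _; rewrite IH.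
Qed.

Lemma sumseqZr Om j c phi :
  sumseq Om j (fun l => phi l * c) = sumseq Om j phi * c.
Proof.
elim: j phi => //= j IH phi; rewrite mulr_suml.
by apply: eq_bigr => x _; rewrite IH.
Qed.

Lemma sumseq_sum Om j (I : Type) (r : seq I) (P : pred I) (F : I -> seq T -> R) :
  sumseq Om j (fun l => \sum_(i <- r | P i) F i l)
  = \sum_(i <- r | P i) sumseq Om j (F i).
Proof.
elim: j F => //= j IH F; rewrite exchange_big.
by apply: eq_bigr => x _; rewrite IH.
Qed.

Lemma exchange_sumseq Om Om' i j (F : seq T -> seq T -> R) :
  sumseq Om i (fun l => sumseq Om' j (F l))
  = sumseq Om' j (fun l' => sumseq Om i (fun l => F l l')).
Proof.
elim: i F => //= i IH F; rewrite sumseq_sum.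
by apply: eq_bigr => x _; rewrite IH.
Qed.

Lemma sumseq_cat Om i j phi :
  sumseq Om (i + j) phi = sumseq Om i (fun l => sumseq Om j (fun l' => phi (l ++ l'))).
Proof. by elim: i phi => //= i IH phi; apply: eq_bigr => x _; rewrite IH. Qed.

Lemma sumseq_subset Om Om' j phi : Om \subset Om' ->
  (forall l, 0 <= phi l) ->
  (forall l, ~~ all (mem Om) l -> phi l = 0) ->
  sumseq Om' j phi = sumseq Om j phi.
Proof.
move=> /fintype.subsetP sO; elim: j phi => //= j IH phi p0 H.
rewrite (bigID (mem Om)) /= [X in _ + X]big1 ?addr0.
  rewrite (eq_bigl (fun x => x \in Om)) => [|x]; last first.
    by case: (boolP (x \in Om)) => [/sO->|]; rewrite ?andbF.
  apply: eq_bigr => x xO; apply: IH => [l|l nl]; first exact: p0.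
  by apply: H => /=; rewrite xO.
move=> x /andP[_ xO].
have -> : sumseq Om' j (fun l => phi (x :: l)) = sumseq Om' j (fun l => 0 * phi l).
  by apply: eq_sumseq => l _ _; rewrite mul0r H //= (negbTE xO).
by rewrite sumseqZ mul0r.
Qed.

End SumSeq.

Section UniqCount.
Variables (R : numDomainType) (T : finType).

(** [Z] holds the vertices already used: each new entry is moved into [Z], so the number of choices
    drops by one per step and a falling factorial appears. *)
Lemma sumseq_uniq (Z : seq T) j :
  uniq Z -> sumseq [set: T] j (fun l => (uniq (l ++ Z))%:R : R)
            = ((#|T| - size Z) ^_ j)%:R.
Proof.
elim: j Z => [|j IH] Z uZ /=; first by rewrite uZ.
rewrite (bigID (mem Z)) /= [X in X + _]big1 ?add0r; last first.
  move=> x /andP[_ xZ].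
  have -> : sumseq [set: T] j (fun l => (uniq ((x :: l) ++ Z))%:R : R)
     = sumseq [set: T] j (fun l => 0 * (uniq l)%:R).
    apply: eq_sumseq => l _ _; rewrite mul0r /= mem_cat.
    by move: xZ => /= ->; rewrite orbT.
  by rewrite sumseqZ mul0r.
rewrite (eq_bigr (fun _ => ((#|T| - (size Z).+1) ^_ j)%:R)).
  rewrite sumr_const -mulrnA.
  have -> : #|[pred i | (i \in [set: T]) & i \notin Z]| = (#|T| - size Z)%N.
    rewrite -(card_uniqP uZ) -(cardC (mem Z)) addKn.
    by apply: eq_card => x; rewrite !inE.
  by rewrite ffactnS mulnC subnS.
move=> x /andP[_ xZ].
rewrite -(IH (x :: Z)) /=; last by rewrite xZ.
apply: eq_sumseq => l _ _; congr (nat_of_bool _)%:R.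
exact: (uniq_catCA [:: x] l Z).
Qed.

End UniqCount.

(** * Walks weighted by the edges shared with a path *)

(** In units of [N ^+ j], [B] bounds the sum over walks with a free start, and [B / (1 - r) + 1] the
    runs along each of the two directions of the path. *)
Definition walk_const (R : realFieldType) (r : R) : R :=
  let B := 2 * (1 + 2 / (1 - r)) in B + 2 * B / (1 - r) + 2.

Lemma walk_const_gt0 (R : realFieldType) (r : R) : r < 1 -> 0 < walk_const r.
Proof.
move=> r1; have r' : 0 < (1 - r)^-1 by rewrite invr_gt0 subr_gt0.
rewrite /walk_const; set B := 2 * _.
have B0 : 0 < B by rewrite /B; lra.
by rewrite !addr_gt0 // divr_gt0 ?subr_gt0 // mulr_gt0.
Qed.

Section Walks.
Variables (R : realFieldType) (T : finType).
Variables (beta : R) (adj : rel T).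
Hypothesis beta_ge1 : 1 <= beta.

Fixpoint walk_weight (x : T) (l : seq T) : R :=
  if l is y :: l' then (if adj x y then beta else 1) * walk_weight y l' else 1.

Definition path_weight x l : R := if uniq (x :: l) then walk_weight x l else 0.

Definition tail_weight l : R := if l is y :: l' then path_weight y l' else 1.

(* Majorant of the weight of a walk that has just followed a shared edge in
   direction [h]: the run of shared edges continues along [h] until it is left
   for good, after which only the weight of the remaining walk matters. *)
Fixpoint run_weight (h : T -> T) x l : R :=
  if l is y :: l' then path_weight y l' + beta * ((y == h x)%:R * run_weight h y l')
  else 1.

Lemma walk_weight_cat x l y l' :
  walk_weight x (l ++ y :: l') = walk_weight x (rcons l y) * walk_weight y l'.
Proof. by elim: l x => [|z l IH] x /=; rewrite ?mulr1 // IH mulrA. Qed.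

Lemma walk_weight_gt0 x l : 0 < walk_weight x l.
Proof.
elim: l x => //= y l IH x; apply: mulr_gt0 (IH y).
by case: ifP => // _; apply: lt_le_trans beta_ge1.
Qed.

Lemma path_weight_ge0 x l : 0 <= path_weight x l.
Proof. by rewrite /path_weight; case: ifP => // _; apply/ltW/walk_weight_gt0. Qed.

Lemma tail_weight_ge0 l : 0 <= tail_weight l.
Proof. by case: l => //= *; apply: path_weight_ge0. Qed.

Lemma run_weight_ge0 h x l : 0 <= run_weight h x l.
Proof.
elim: l x => //= y l IH x; rewrite addr_ge0 ?path_weight_ge0 //.
by rewrite !mulr_ge0 // (le_trans _ beta_ge1).
Qed.

(** * Shared runs along the successor [f] and predecessor [b] of a fixed path *)

Section Direction.
Variables f b : T -> T.
Hypotheses (fK : cancel f b) (bK : cancel b f).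
Hypothesis adj_fb : forall x y, adj x y -> (y == f x) || (y == b x).
Variable S : {set T}.
Hypothesis adjS : forall x y, adj x y -> x \in S.

(* A self-avoiding walk that follows a shared edge in one direction cannot turn back. *)
Lemma walk_weight_run h h' x l :
  cancel h h' -> (forall x y, adj x y -> (y == h x) || (y == h' x)) ->
  uniq (h' x :: x :: l) -> walk_weight x l <= run_weight h x l.
Proof.
move=> hK adjh; elim: l x => //= y l IH x.
rewrite !inE !negb_or => /and4P[/and3P[_ h'y h'l] /andP[xy xl] yl ul].
have pwE : path_weight y l = walk_weight y l by rewrite /path_weight /= yl ul.
case: ifP => [axy|_]; last first.
  rewrite mul1r -pwE lerDl !mulr_ge0 ?run_weight_ge0 //.
  by rewrite (le_trans _ beta_ge1).
have yE : y = h x.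
  by case/orP: (adjh _ _ axy) => /eqP // yE; rewrite yE eqxx in h'y.
have -> : (y == h x) = true by apply/eqP.
rewrite mul1r (le_trans (y := beta * run_weight h y l)) ?lerDr ?path_weight_ge0 //.
rewrite ler_wpM2l ?(le_trans _ beta_ge1) // IH //=.
rewrite [h' y](_ : _ = x) ?inE ?negb_or ?xy ?xl ?yl //.
by rewrite yE hK.
Qed.

(** A first step that is not shared has weight 1 and leaves the tail. A shared one starts in [S] and
    follows [f] or [b]; self-avoidance then keeps the run in that direction, by
    [walk_weight_run]. *)
Lemma path_weight_le x l :
  path_weight x l <= tail_weight l
     + (x \in S)%:R * (run_weight f x l + run_weight b x l).
Proof.
have rhs0 y m : 0 <= (y \in S)%:R * (run_weight f y m + run_weight b y m).
  by rewrite mulr_ge0 // addr_ge0 // run_weight_ge0.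
case: l => [|y l] /=; first by rewrite /path_weight /= lerDl mulr_ge0 ?addr_ge0 ?ler01.
have b0 : 0 <= beta by rewrite (le_trans _ beta_ge1).
rewrite {1}/path_weight /=; case: ifP => [|_]; last first.
  by rewrite addr_ge0 ?path_weight_ge0 // mulr_ge0 // !addr_ge0 ?path_weight_ge0 //
     !mulr_ge0 // run_weight_ge0.
rewrite inE negb_or => /and3P[/andP[xy xl] yl ul].
have pwE : path_weight y l = walk_weight y l by rewrite /path_weight /= yl ul.
case: ifP => [axy|_]; last first.
  by rewrite mul1r pwE lerDl mulr_ge0 // -pwE !addr_ge0 ?path_weight_ge0 //
     !mulr_ge0 // run_weight_ge0.
rewrite (adjS axy) mul1r.
have H h h' : cancel h h' -> (forall x y, adj x y -> (y == h x) || (y == h' x)) ->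
   y == h x -> walk_weight y l <= (y == h x)%:R * run_weight h y l.
  move=> hK adjh yh; rewrite yh mul1r; move/eqP: yh => yE; apply: (walk_weight_run hK adjh).
  by rewrite {1}yE hK /= inE negb_or xy xl yl.
have H0 h : 0 <= beta * ((y == h x)%:R * run_weight h y l).
  by rewrite !mulr_ge0 // run_weight_ge0.
have p0 := path_weight_ge0 y l.
case/orP: (adj_fb axy) => yh.
  have := ler_wpM2l b0 (H f b fK adj_fb yh); have := H0 b; lra.
have adj_bf x' y' : adj x' y' -> (y' == b x') || (y' == f x').
  by move/adj_fb; rewrite orbC.
have := ler_wpM2l b0 (H b f bK adj_bf yh); have := H0 f; lra.
Qed.

Variables (Om : {set T}) (w : T).

(** All three sums run over walks ending at [w] with [j] summed vertices from [Om]. In [path_sum]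
    and [run_sum] the start [x] is given; in [tail_sum] the start is the first summed vertex, or [w]
    itself when [j = 0]. *)
Definition tail_sum j : R := sumseq Om j (fun l => tail_weight (rcons l w)).
Definition path_sum j x : R := sumseq Om j (fun l => path_weight x (rcons l w)).
Definition run_sum h j x : R := sumseq Om j (fun l => run_weight h x (rcons l w)).

Lemma tail_sum0 : tail_sum 0 = 1. Proof. by []. Qed.

Lemma tail_sumS j : tail_sum j.+1 = \sum_(x in Om) path_sum j x.
Proof. by []. Qed.

Lemma tail_sum_ge0 j : 0 <= tail_sum j.
Proof. by apply: sumseq_ge0 => l _ _; apply: tail_weight_ge0. Qed.

Lemma path_sum_le j x :
  path_sum j x <= tail_sum j + (x \in S)%:R * (run_sum f j x + run_sum b j x).
Proof.
rewrite /run_sum -sumseqD -sumseqZ -sumseqD.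
by apply: le_sumseq => l _ _; apply: path_weight_le.
Qed.

Lemma run_sum_ge0 h j x : 0 <= run_sum h j x.
Proof. by apply: sumseq_ge0 => l _ _; apply: run_weight_ge0. Qed.

Lemma run_sumS h j x :
  run_sum h j.+1 x <= tail_sum j.+1 + beta * run_sum h j (h x).
Proof.
have b0 : 0 <= beta by rewrite (le_trans _ beta_ge1).
rewrite /run_sum /=.
under eq_bigr => y _ do rewrite sumseqD !sumseqZ.
rewrite big_split /= lerD2l -mulr_sumr ler_wpM2l //.
case: (boolP (h x \in Om)) => [hO|hO].
  rewrite (bigD1 (h x)) //= eqxx mul1r big1 ?addr0 // => y /andP[_ /negPf->].
  by rewrite mul0r.
rewrite big1 ?run_sum_ge0 // => y yO; case: eqP => [yE|_]; last by rewrite mul0r.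
by rewrite -yE yO in hO.
Qed.

(** Iterating [run_sumS], the index [i] counts the further shared steps made before the run is left;
    the last term is the run that never leaves and ends at [w]. *)
Lemma run_sum_bound h j x :
  run_sum h j x <= \sum_(i < j.+1) beta ^+ i * tail_sum (j - i)
                   + beta ^+ j.+1 * (w == iter j.+1 h x)%:R.
Proof.
have b0 : 0 <= beta by rewrite (le_trans _ beta_ge1).
elim: j x => [|j IH] x.
  rewrite /run_sum /= big_ord1 expr0 mul1r /tail_sum /= /path_weight /=.
  by rewrite mulr1 expr1.
rewrite (le_trans (run_sumS _ _ _)) // big_ord_recl expr0 mul1r subn0 -addrA lerD2l.
rewrite (le_trans (ler_wpM2l b0 (IH (h x)))) // mulrDr mulr_sumr mulrA -exprS.
rewrite -iterSr lerD2r; apply: ler_sum => i _.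
by rewrite mulrA -exprS lift0 subSS.
Qed.

(** As [h] is injective, at most one starting vertex lets the run reach [w], so the full-run power
    of [beta] is paid once and not [#|S|] times. *)
Lemma sum_run_sum h h' j : cancel h h' ->
  \sum_(x in S) run_sum h j x
  <= #|S|%:R * \sum_(i < j.+1) beta ^+ i * tail_sum (j - i) + beta ^+ j.+1.
Proof.
have b0 : 0 <= beta by rewrite (le_trans _ beta_ge1).
move=> hK; rewrite (le_trans (ler_sum _ (fun x _ => run_sum_bound h j x))) //.
rewrite big_split /= sumr_const mulr_natl lerD2l -mulr_sumr ler_piMr ?exprn_ge0 //.
have iK x : iter j.+1 h' (iter j.+1 h x) = x.
  by elim: j.+1 x => // i IH x; rewrite iterSr iterS hK.
rewrite (le_trans (y := \sum_(x : T) (x == iter j.+1 h' w)%:R)) //.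
  rewrite big_mkcond /=; apply: ler_sum => x _; case: ifP => // _.
  case: (w =P _) => [->|_ //]; by rewrite -iterS iK eqxx.
by rewrite (bigD1 (iter j.+1 h' w)) //= eqxx big1 ?addr0 // => x /negPf->.
Qed.

Lemma tail_sum_rec j :
  tail_sum j.+1 <= #|Om|%:R * tail_sum j
    + 2 * (#|S|%:R * \sum_(i < j.+1) beta ^+ i * tail_sum (j - i)) + 2 * beta ^+ j.+1.
Proof.
rewrite tail_sumS (le_trans (ler_sum _ (fun x _ => path_sum_le j x))) //.
rewrite big_split /= sumr_const mulr_natl -addrA lerD2l.
apply: (@le_trans _ _ (\sum_(x in S) (run_sum f j x + run_sum b j x))).
  rewrite [leRHS]big_mkcond [leLHS]big_mkcond /=; apply: ler_sum => x _.
  case: (x \in S); rewrite ?mul1r ?mul0r; case: (x \in Om) => //.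
  by rewrite addr_ge0 // run_sum_ge0.
rewrite big_split /=; have := sum_run_sum j fK; have := sum_run_sum j bK; lra.
Qed.

(** * Geometric bounds for the walk sums *)

Section Bounds.
Variables (r : R) (J : nat).
Let N : R := #|Om|%:R.
Hypotheses (r0 : 0 < r) (r1 : r < 1) (N0 : 0 < N) (betaN : beta <= r * N).
Hypothesis JSN : 4 * J%:R * #|S|%:R <= (1 - r) * N.

Let B : R := 2 * (1 + 2 / (1 - r)).

Lemma tail_const_ge0 : 0 <= B.
Proof. by rewrite /B mulr_ge0 // addr_ge0 // divr_ge0 // subr_ge0 ltW. Qed.

Lemma geometric_sum_le k : \sum_(i < k) r ^+ i <= (1 - r)^-1.
Proof.
rewrite -[leRHS]mul1r ler_pdivlMr ?subr_gt0 // mulrC.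
have -> : (1 - r) * \sum_(i < k) r ^+ i = 1 - r ^+ k.
  by rewrite -[RHS]opprB subrX1 -mulNr opprB.
by rewrite lerBlDr lerDl exprn_ge0 // ltW.
Qed.

Lemma beta_exp_le i : beta ^+ i <= r ^+ i * N ^+ i.
Proof.
by rewrite -exprMn lerXn2r ?nnegrE ?mulr_ge0 ?(ltW r0) ?(ltW N0) ?(le_trans _ beta_ge1).
Qed.

(** A shared step costs [beta <= r * N] where a free vertex contributes [N], so the convolution is
    dominated by a geometric series of ratio [r]. *)
Lemma conv_tail_sum_le j : (forall i, (i <= j)%N -> tail_sum i <= B * N ^+ i) ->
  \sum_(i < j.+1) beta ^+ i * tail_sum (j - i) <= B / (1 - r) * N ^+ j.
Proof.
move=> H.
apply: (@le_trans _ _ (\sum_(i < j.+1) (r ^+ i * (B * N ^+ j)))).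
  apply: ler_sum => i _.
  have -> : r ^+ i * (B * N ^+ j) = (r ^+ i * N ^+ i) * (B * N ^+ (j - i)).
    have -> : N ^+ j = N ^+ i * N ^+ (j - i) by rewrite -exprD subnKC // -ltnS.
    ring.
  apply: ler_pM; rewrite ?exprn_ge0 ?tail_sum_ge0 ?(le_trans _ beta_ge1) ?beta_exp_le //.
  by rewrite H ?leq_subr.
rewrite -mulr_suml [B / _]mulrC -[leRHS]mulrA.
rewrite ler_wpM2r ?geometric_sum_le //.
by apply: mulr_ge0; rewrite ?tail_const_ge0 ?exprn_ge0 ?ltW.
Qed.

(** [B] solves [1 + B / 2 + 2 / (1 - r) = B], which is what closes the induction on the tail
    sums. *)
Lemma tail_const_step (e g : R) : g <= (1 - r)^-1 -> B * e <= B * 1 -> 1 + B / 2 * e + 2 * g <= B.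
Proof. rewrite /B; lra. Qed.

(** The constant may grow with [j]: by [tail_sum_rec] a step adds at most [B / (2 * J)] for runs
    that are left again and [2 * r ^+ j] for a run reaching [w]. Over [J] steps it stays below [B],
    the bound that [conv_tail_sum_le] needs at the next step. *)
Lemma tail_sum_partial_bound j : (j <= J)%N ->
  tail_sum j <= (1 + B / 2 * (j%:R / J%:R) + 2 * \sum_(i < j) r ^+ i) * N ^+ j.
Proof.
have NN : forall i, 0 < N ^+ i by move=> i; rewrite exprn_gt0.
elim/ltn_ind: j => -[|j] IH jJ.
  by rewrite big_ord0 tail_sum0 mul0r !mulr0 !addr0 mulr1.
have J0 : (0 : R) < J%:R by rewrite ltr0n (leq_trans _ jJ).
have IHB i : (i <= j)%N -> tail_sum i <= B * N ^+ i.
  move=> ij; rewrite (le_trans (IH i ij (leq_trans ij (ltnW jJ)))) //.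
  rewrite ler_wpM2r ?(ltW (NN _)) //.
  have iJ : i%:R / J%:R <= 1 :> R.
    by rewrite ler_pdivrMr // mul1r ler_nat (leq_trans ij) // ltnW.
  exact: (tail_const_step (geometric_sum_le i) (ler_wpM2l tail_const_ge0 iJ)).
rewrite (le_trans (tail_sum_rec j)) //.
have H1 := IH j (ltnSn j) (ltnW jJ).
have H2 := conv_tail_sum_le IHB.
have H3 := beta_exp_le j.+1.
set c := \sum_(i < j.+1) _ in H2 *.
(* [JSN] cancels the factor [1 / (1 - r)] of the convolution and leaves a share of order [1 / J]. *)
have H4 : #|S|%:R * c <= B / 4 / J%:R * N ^+ j.+1.
  rewrite (le_trans (ler_wpM2l (ler0n _ _) H2)) //.
  have S4 : #|S|%:R <= (1 - r) * N / (4 * J%:R).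
    by rewrite ler_pdivlMr ?mulr_gt0 // mulrC.
  have c0 : 0 <= B / (1 - r) * N ^+ j.
    by rewrite mulr_ge0 ?(ltW (NN _)) // mulr_ge0 ?tail_const_ge0 // invr_ge0 subr_ge0 ltW.
  rewrite (le_trans (ler_wpM2r c0 S4)) //.
  rewrite le_eqVlt; apply/orP; left; apply/eqP; rewrite exprS; field.
  by rewrite subr_eq0 !gt_eqF.
have H5 : N * tail_sum j <= (1 + B / 2 * (j%:R / J%:R) + 2 * \sum_(i < j) r ^+ i) * N ^+ j.+1.
  by rewrite exprS mulrCA ler_wpM2l // ltW.
rewrite big_ord_recr /=.
have H6 : \sum_(i < j) r ^+ i + r ^+ j.+1 <= \sum_(i < j) r ^+ i + r ^+ j.
  by rewrite lerD2l exprS ler_piMl ?exprn_ge0 // ltW.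
have -> : j.+1%:R / J%:R = j%:R / J%:R + J%:R^-1 :> R by rewrite -natr1 mulrDl mul1r.
have := ler_wpM2r (ltW (NN j.+1)) H6.
move: H3 H4 H5; rewrite -/N.
set M := N ^+ j.+1; set q := \sum_(i < j) _; set z := j%:R / _; set e := J%:R^-1.
move=> H3 H4 H5 H7.
apply: (le_trans (lerD (lerD H5 (ler_wpM2l (ler0n _ 2) H4)) (ler_wpM2l (ler0n _ 2) H3))).
lra.
Qed.

Lemma tail_sum_bound j : (j <= J)%N -> tail_sum j <= B * N ^+ j.
Proof.
move=> jJ; rewrite (le_trans (tail_sum_partial_bound jJ)) //.
rewrite ler_wpM2r ?exprn_ge0 ?(ltW N0) //.
have iJ : j%:R / J%:R <= 1 :> R.
  case: J jJ => [|J' jJ]; first by rewrite invr0 mulr0 ler01.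
  by rewrite ler_pdivrMr ?ltr0n // mul1r ler_nat.
exact: (tail_const_step (geometric_sum_le j) (ler_wpM2l tail_const_ge0 iJ)).
Qed.

(* [N * r ^+ j.+1] accounts for the walks sharing every edge with the given path. *)
Lemma path_sum_bound j x : (j <= J)%N -> N * r ^+ j.+1 <= 1 ->
  path_sum j x <= walk_const r * N ^+ j.
Proof.
rewrite /walk_const -/B => jJ Nr; have B0 := tail_const_ge0.
have rs h : run_sum h j x <= B / (1 - r) * N ^+ j + N ^+ j.
  rewrite (le_trans (run_sum_bound h j x)) // lerD //.
    by apply: conv_tail_sum_le => i ij; rewrite tail_sum_bound // (leq_trans ij).
  rewrite (le_trans (y := beta ^+ j.+1)) ?ler_piMr ?exprn_ge0 ?(le_trans _ beta_ge1) //.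
    by rewrite lern1 leq_b1.
  rewrite (le_trans (beta_exp_le _)) // (exprS N) mulrA [_ * N]mulrC.
  by rewrite ler_piMl // exprn_ge0 // ltW.
rewrite (le_trans (path_sum_le j x)) //.
have : (x \in S)%:R * (run_sum f j x + run_sum b j x) <= run_sum f j x + run_sum b j x.
  by rewrite ler_piMl ?addr_ge0 ?run_sum_ge0 // lern1 leq_b1.
have := rs f; have := rs b; have := tail_sum_bound jJ.
set M := N ^+ j.
have -> : 2 * B / (1 - r) = 2 * (B / (1 - r)) by rewrite mulrA.
lra.
Qed.

End Bounds.

End Direction.
End Walks.

(** * Edges of walks and the Erdos-Renyi measure *)

Definition pairs n : graph n := [set e : 'I_n * 'I_n | (e.1 < e.2)%N].

Fixpoint walk_edges n (x : 'I_n) (l : seq 'I_n) : graph n :=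
  if l is y :: l' then upair x y |: walk_edges y l' else finset.set0.

Lemma walk_edges_cat n (x y : 'I_n) l l' :
  walk_edges x (l ++ y :: l') = walk_edges x (rcons l y) :|: walk_edges y l'.
Proof. by elim: l x => [|z l IH] x /=; rewrite ?finset.setU0 // IH finset.setUA. Qed.

Lemma upair_pairs n (x y : 'I_n) : x != y -> upair x y \in pairs n.
Proof. by move=> xy; rewrite inE /upair; case: ifP => //=; move: xy; rewrite -val_eqE /=; lia. Qed.

Lemma upair_inj n (x y x' y' : 'I_n) : upair x y = upair x' y' ->
  (x = x' /\ y = y') \/ (x = y' /\ y = x').
Proof. by rewrite /upair; case: ifP; case: ifP => _ _ [-> ->]; auto. Qed.

Lemma walk_edges_pairs n (x : 'I_n) l : uniq (x :: l) -> walk_edges x l \subset pairs n.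
Proof.
elim: l x => [|y l IH] x; first by rewrite finset.sub0set.
rewrite [uniq _]/= inE negb_or => /andP[/andP[xy _] u].
by rewrite /= finset.subUset finset.sub1set upair_pairs //= IH.
Qed.

Lemma walk_edgesP n (x0 : 'I_n) l x y : upair x y \in walk_edges x0 l ->
  exists p1 p2, x0 :: l = p1 ++ [:: x, y & p2] \/ x0 :: l = p1 ++ [:: y, x & p2].
Proof.
elim: l x0 => [|z l IH] x0 /=; first by rewrite inE.
rewrite !inE => /orP[/eqP/upair_inj|/IH [p1 [p2 H]]].
  by case=> -[-> ->]; exists [::], l; [left|right].
by exists (x0 :: p1), p2; case: H => ->; [left|right].
Qed.

Lemma next_consecutive (T : eqType) (p1 p2 : seq T) x y :
  uniq (p1 ++ [:: x, y & p2]) -> next (p1 ++ [:: x, y & p2]) x = y.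
Proof.
by move=> u; rewrite -(next_rot (size p1) u) rot_size_cat /= eqxx.
Qed.

(** [next] and [prev] close the path into a cycle, which makes them mutually inverse on all
    vertices. The extra closing pair does no harm, since the implication only goes from edges to
    neighbours. *)
Lemma walk_edges_next_prev n (x0 : 'I_n) l x y :
  uniq (x0 :: l) -> upair x y \in walk_edges x0 l ->
  (y == next (x0 :: l) x) || (y == prev (x0 :: l) x).
Proof.
move=> u /walk_edgesP[p1 [p2 [] E]]; rewrite E in u *.
  by rewrite next_consecutive // eqxx.
by have := prev_next u y; rewrite next_consecutive // => ->; rewrite eqxx orbT.
Qed.

Lemma walk_edges_mem n (x0 : 'I_n) l x y :
  upair x y \in walk_edges x0 l -> x \in x0 :: l.
Proof.
by move=> /walk_edgesP[p1 [p2 [] ->]]; rewrite mem_cat !inE eqxx ?orbT.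
Qed.

(** [walk_weight] counts a shared edge each time it is crossed, the cardinal only once; this is an
    inequality because [beta] is at least 1. *)
Lemma exp_card_walk_edges (R : realFieldType) (beta : R) n (A : graph n) x l :
  1 <= beta ->
  beta ^+ #|A :&: walk_edges x l| <= walk_weight beta (fun y z => upair y z \in A) x l.
Proof.
move=> b1; elim: l x => [|y l IH] x /=; first by rewrite finset.setI0 finset.cards0.
case: ifP => xyA; last first.
  rewrite mul1r (le_trans _ (IH y)) // ler_weXn2l // subset_leq_card //.
  apply/fintype.subsetP => e; rewrite !inE => /andP[eA]; rewrite eA.
  by case: eqP => // eE; rewrite eE xyA in eA.
rewrite (le_trans _ (ler_wpM2l _ (IH y))) ?(le_trans _ b1) //.
rewrite -exprS ler_weXn2l // finset.setIUr.
rewrite (leq_trans (leq_card_setU _ _)) // -add1n leq_add2r.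
rewrite (leq_trans (subset_leq_card (finset.subsetIr _ _))) //.
by rewrite finset.cards1.
Qed.

Section ErdosRenyi.
Variables (R : realType) (n : nat) (p : R).
Hypotheses (p0 : 0 < p) (p1 : p <= 1).
Implicit Types (G S A : graph n) (psi : graph n -> R).

(** With factor 0 for a present pair out of order and 1 for an absent one, the product runs over all
    ordered pairs, and a sum over graphs distributes over it. *)
Lemma ER_probE G : ER_prob p G =
  \prod_(e : 'I_n * 'I_n) (if e \in G then (if e \in pairs n then p else 0)
                           else (if e \in pairs n then 1 - p else 1)).
Proof.
rewrite /ER_prob; case: ifPn => [/fintype.subsetP GP|/subsetPn[e eG eP]].
  rewrite big_mkcond; apply: eq_bigr => e _; rewrite !inE /=.
  by case: (boolP (e \in G)) => // /GP; rewrite inE => ->.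
by rewrite (bigD1 e) //= eG (negbTE eP) mul0r.
Qed.

Lemma ER_prob_ge0 G : 0 <= ER_prob p G.
Proof.
rewrite ER_probE prodr_ge0 // => e _; case: ifP => _; case: ifP => _ //; first exact: ltW.
by rewrite subr_ge0.
Qed.

Lemma sum_ER_prob : \sum_(G : graph n) ER_prob p G = 1.
Proof.
under eq_bigr do rewrite ER_probE.
rewrite -(bigA_distr _ _ (fun e => if e \in pairs n then p else 0)
                    (fun e => if e \in pairs n then 1 - p else 1)).
rewrite big1 // => e _; case: ifP => _ /=; [exact: subrKC|exact: add0r].
Qed.

(** Graphs are paired by toggling [e]: the masses without and with [e] are in ratio [1 - p] to [p],
    so the graph with [e] carries the fraction [p] of its pair. *)
Lemma ER_prob_setU1 e psi : e \in pairs n ->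
  p * \sum_(G : graph n) ER_prob p G * psi (e |: G)
  = \sum_(G : graph n) ER_prob p G * ((e \in G)%:R * psi G).
Proof.
move=> eP.
have H1 : \sum_(G : graph n | e \notin G) ER_prob p G * psi (e |: G)
  = \sum_(G : graph n | e \in G) ER_prob p (G :\ e) * psi G.
  rewrite (reindex_onto (fun G => G :\ e) (fun G => e |: G)) /=; last first.
    by move=> G eG; rewrite finset.setU1K.
  apply: eq_big => G; last by move=> /andP[_ /eqP->].
  rewrite !inE eqxx /=; case: (boolP (e \in G)) => eG; first by rewrite finset.setD1K // eqxx.
  apply/eqP => H; move: eG; rewrite -H; by rewrite !inE eqxx.
have H2 G : e \in G -> p * ER_prob p (G :\ e) = (1 - p) * ER_prob p G.
  move=> eG; rewrite !ER_probE [in LHS](bigD1 e) //= [in RHS](bigD1 e) //=.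
  rewrite !inE eqxx eG /= -[(_ < _)%N]/(_) ; move: (eP); rewrite inE => ->.
  rewrite mulrCA; congr (_ * (_ * _)).
  by apply: eq_bigr => e' ee'; rewrite !inE ee'.
rewrite (bigID (fun G => e \in G)) /= H1 -big_split /= [RHS](bigID (fun G => e \in G)) /=.
rewrite [X in _ = _ + X]big1 ?addr0; last by move=> G /negPf->; rewrite mul0r mulr0.
rewrite mulr_sumr; apply: eq_bigr => G eG.
have -> : e |: G = G by apply/finset.setUidPr; rewrite finset.sub1set.
by rewrite eG mul1r mulrDr [X in _ + X]mulrA H2 //; ring.
Qed.

(* Planting the edges of [S] amounts to conditioning on their presence. *)
Lemma ER_prob_setU S psi : S \subset pairs n ->
  \sum_(G : graph n) ER_prob p G * psi (G :|: S)
  = \sum_(G : graph n) ER_prob p G * (p ^- #|S| * (S \subset G)%:R * psi G).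
Proof.
have [k] := ubnP #|S|; elim: k S psi => // k IH S psi Sk SP.
case: (set_0Vmem S) => [->|[e eS]].
  apply: eq_bigr => G _.
  by rewrite finset.setU0 finset.cards0 expr0 invr1 mul1r finset.sub0set mul1r.
have SE : S = e |: (S :\ e) by rewrite finset.setD1K.
have cS : #|S| = #|S :\ e|.+1 by rewrite (cardsD1 e) eS.
have eP : e \in pairs n by apply: (fintype.subsetP SP).
have -> : \sum_(G : graph n) ER_prob p G * psi (G :|: S)
    = \sum_(G : graph n) ER_prob p G * psi (e |: (G :|: S :\ e)).
  by apply: eq_bigr => G _; rewrite {1}SE finset.setUCA.
rewrite (IH (S :\ e) (fun G => psi (e |: G))); last first.
- by rewrite (fintype.subset_trans (subsetDl _ _)).
- by rewrite -ltnS -cS.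
have E G : (S :\ e \subset G) = (S :\ e \subset e |: G).
  by rewrite !finset.subDset finset.setUA finset.setUid.
under eq_bigr => G _ do rewrite E.
have := ER_prob_setU1 (fun G => p ^- #|S :\ e| * (S :\ e \subset G)%:R * psi G) eP.
move/(congr1 (fun x => p^-1 * x)); rewrite mulKf ?gt_eqF // => ->.
rewrite mulr_sumr; apply: eq_bigr => G _.
have -> : (S \subset G)%:R = (e \in G)%:R * (S :\ e \subset G)%:R :> R.
  rewrite -natrM mulnb; congr (nat_of_bool _)%:R.
  by rewrite {1}SE finset.subUset finset.sub1set.
by rewrite cS exprS invfM; ring.
Qed.

Lemma ER_prob_subset S : S \subset pairs n ->
  \sum_(G : graph n) ER_prob p G * (S \subset G)%:R = p ^+ #|S|.
Proof.
move=> SP; have := ER_prob_setU (fun _ => 1) SP.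
under eq_bigr do rewrite mulr1; rewrite sum_ER_prob.
under eq_bigr do rewrite mulr1 mulrCA; rewrite -mulr_sumr.
by move/(congr1 (fun x => p ^+ #|S| * x)); rewrite mulr1 mulVKf ?expf_neq0 ?gt_eqF // => ->.
Qed.

(** The product of the two likelihood ratios has mean [p] to the power [#|S :|: A| - #|S| - #|A|];
    inclusion-exclusion leaves only the shared edges. *)
Lemma ER_prob_subset2 S A : S \subset pairs n -> A \subset pairs n ->
  \sum_(G : graph n) ER_prob p G * ((p ^- #|S| * (S \subset G)%:R) * (p ^- #|A| * (A \subset G)%:R))
  = p^-1 ^+ #|S :&: A|.
Proof.
move=> SP AP.
have -> : p^-1 ^+ #|S :&: A| = p ^- #|S| * p ^- #|A| * p ^+ #|S :|: A|.
  have pn i : p ^+ i != 0 by rewrite expf_neq0 // gt_eqF.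
  have := cardsUI S A => /(congr1 (fun i => p ^+ i)); rewrite !exprD => /eqP E.
  rewrite exprVn; apply/eqP; rewrite -(inj_eq (mulfI (pn #|S|))) -(inj_eq (mulfI (pn #|A|))).
  rewrite -(inj_eq (mulIf (pn #|S :&: A|))) !mulrA.
  move: E; move: (pn #|S|) (pn #|A|) (pn #|S :&: A|) (pn #|S :|: A|).
  set a := p ^+ _; set b := p ^+ _; set c := p ^+ _; set d := p ^+ _.
  move=> a0 b0 c0 d0 E; rewrite mulfVK // [b * a]mulrC.
  by rewrite [X in _ == X](_ : _ = d * c) 1?eq_sym //; field; rewrite a0 b0.
rewrite -(ER_prob_subset (S := S :|: A)) ?finset.subUset ?SP // mulr_sumr; apply: eq_bigr => G _.
rewrite finset.subUset -mulnb natrM; ring.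
Qed.

End ErdosRenyi.

(** * Second moment of the planted segment *)

Definition path_graph n (l : seq 'I_n) : graph n :=
  if l is x :: l' then walk_edges x l' else finset.set0.

Lemma path_graph_rcons_cat n (l l' : seq 'I_n) x :
  path_graph (rcons l x ++ l') = path_graph (rcons l x) :|: walk_edges x l'.
Proof.
case: l => [|y l] /=; first by rewrite finset.set0U.
by rewrite cat_rcons walk_edges_cat.
Qed.

Lemma path_graph_window n (A B y z : seq 'I_n) a b v :
  path_graph (rcons A a ++ y ++ v :: z ++ b :: B)
  = (path_graph (rcons A a) :|: path_graph (b :: B)) :|: walk_edges a (y ++ v :: rcons z b).
Proof.
rewrite path_graph_rcons_cat -cat_cons catA walk_edges_cat -finset.setUA; congr (_ :|: _).
by rewrite finset.setUC; congr (_ :|: walk_edges _ _); rewrite rcons_cat.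
Qed.

Lemma perm_window (T : eqType) (A B y z : seq T) v :
  perm_eq (A ++ y ++ v :: z ++ B) ((y ++ z) ++ (A ++ v :: B)).
Proof. by apply/permP => P; rewrite !count_cat /= !count_cat /=; lia. Qed.

Section SecondMoment.
Variables (R : realType) (n : nat) (p : R).
Hypotheses (p0 : 0 < p) (p1 : p <= 1).

Section Planting.
Variables (u : seq 'I_n -> bool) (S : seq 'I_n -> graph n) (m : nat).
Variables (I : pred (graph n)) (D C delta : R).
Hypotheses (D0 : 0 < D) (delta0 : 0 < delta).
Hypothesis uS : forall l, u l -> S l \subset pairs n.
Hypothesis uD : sumseq [set: 'I_n] m (fun l => (u l)%:R : R) = D.
Hypothesis SC : forall l, u l ->
  sumseq [set: 'I_n] m (fun l' => (u l')%:R * p^-1 ^+ #|S l :&: S l'|) <= C * D.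

(** The planted law of the graph, averaged over [u], has density [Y / D]. Pointwise [Y * I <= delta
    / (2 * D) * Y ^ 2 + D / (2 * delta) * I], a Cauchy-Schwarz bound with a tunable [delta], and the
    mean of [Y ^ 2] is the shared-edge sum controlled by [SC]. *)
Lemma planting_second_moment :
  sumseq [set: 'I_n] m
    (fun l => (u l)%:R * \sum_(G : graph n) ER_prob p G * (I (G :|: S l))%:R)
  <= delta / 2 * C * D + D / (2 * delta) * \sum_(G : graph n) ER_prob p G * (I G)%:R.
Proof.
pose X l (G : graph n) : R := (u l)%:R * (p ^- #|S l| * (S l \subset G)%:R).
pose Y G : R := sumseq [set: 'I_n] m (fun l => X l G).
have -> : sumseq [set: 'I_n] m
    (fun l => (u l)%:R * \sum_(G : graph n) ER_prob p G * (I (G :|: S l))%:R)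
  = \sum_(G : graph n) ER_prob p G * (Y G * (I G)%:R).
  transitivity (sumseq [set: 'I_n] m
     (fun l => \sum_(G : graph n) ER_prob p G * (X l G * (I G)%:R))).
    apply: eq_sumseq => l _ _; rewrite /X; case: (boolP (u l)) => ul; last first.
      by rewrite mul0r big1 // => G _; rewrite !mul0r mulr0.
    rewrite mul1r (ER_prob_setU p0 (fun G => (I G)%:R) (uS ul)).
    by apply: eq_bigr => G _; rewrite mul1r.
  by rewrite sumseq_sum; apply: eq_bigr => G _; rewrite sumseqZ sumseqZr.
have YY : \sum_(G : graph n) ER_prob p G * (Y G * Y G) <= C * D * D.
  have -> : \sum_(G : graph n) ER_prob p G * (Y G * Y G)
    = sumseq [set: 'I_n] m (fun l => sumseq [set: 'I_n] m (fun l' =>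
        \sum_(G : graph n) ER_prob p G * (X l G * X l' G))).
    under [RHS]eq_sumseq => l _ _ do rewrite sumseq_sum.
    rewrite sumseq_sum; apply: eq_bigr => G _.
    rewrite {1}/Y -sumseqZr -sumseqZ; apply: eq_sumseq => l _ _.
    by rewrite sumseqZ sumseqZ.
  rewrite -{2}uD -sumseqZ; apply: le_sumseq => l _ _.
  case: (boolP (u l)) => ul; last first.
    rewrite mulr0 (_ : sumseq _ _ _ = sumseq [set: 'I_n] m (fun l => 0 * 0)); last first.
      apply: eq_sumseq => l' _ _; rewrite mul0r big1 // => G _.
      by rewrite /X (negbTE ul) !mul0r mulr0.
    by rewrite sumseqZ mul0r.
  rewrite mulr1 (le_trans _ (SC ul)) //; apply: le_sumseq => l' _ _.
  case: (boolP (u l')) => ul'; last first.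
    rewrite mul0r big1 // => G _.
    by rewrite /X (negbTE ul') !mul0r !mulr0.
  rewrite -(ER_prob_subset2 p0 (uS ul) (uS ul')) mul1r.
  by apply: ler_sum => G _; rewrite /X ul ul' !mul1r.
apply: (@le_trans _ _ (\sum_(G : graph n) (delta / (2 * D) * (ER_prob p G * (Y G * Y G))
     + D / (2 * delta) * (ER_prob p G * (I G)%:R)))).
  apply: ler_sum => G _.
  rewrite [leRHS](_ : _ = ER_prob p G * (delta / (2 * D) * (Y G * Y G)
       + D / (2 * delta) * (I G)%:R)); last by ring.
  rewrite ler_wpM2l ?ER_prob_ge0 //.
  move: (Y G) => a; have a2 : 0 <= delta / (2 * D) * (a * a).
    by rewrite -expr2 mulr_ge0 ?sqr_ge0 // divr_ge0 ?mulr_ge0 ?(ltW D0) ?(ltW delta0).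
  case: (I G); last by rewrite !mulr0 addr0.
  rewrite !mulr1 -subr_ge0.
  have -> : delta / (2 * D) * (a * a) + D / (2 * delta) - a
     = (delta * a - D) ^+ 2 / (2 * D * delta) by field; rewrite !gt_eqF.
  by rewrite divr_ge0 ?sqr_ge0 ?mulr_ge0 ?(ltW D0) ?(ltW delta0).
rewrite big_split /= -!mulr_sumr lerD2r.
rewrite (le_trans (ler_wpM2l _ YY)) ?divr_ge0 ?mulr_ge0 ?(ltW D0) ?(ltW delta0) //.
by rewrite le_eqVlt; apply/orP; left; apply/eqP; field; rewrite gt_eqF.
Qed.
End Planting.
End SecondMoment.

(** * Resampling the hidden segment around one planted vertex *)

Section Window.
Variables (R : realType) (n : nat) (p r : R) (L : nat).
Hypotheses (p0 : 0 < p) (p1 : p <= 1) (r0 : 0 < r) (r1 : r < 1).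

Section Pair.
Variables (A B : seq 'I_n) (a v b : 'I_n).
Let Z := rcons A a ++ v :: b :: B.
Let N := (n - size Z)%N.
Let u y z := uniq (rcons A a ++ y ++ v :: z ++ b :: B).
Let S y z := walk_edges a (y ++ v :: rcons z b).
Hypotheses (N0 : (0 < N)%N) (pN : p^-1 <= r * N%:R).
Hypothesis LN : 4 * L%:R * (2 * L + 3)%:R <= (1 - r) * N%:R.
Hypothesis NrL : N%:R * r ^+ L.+1 <= 1.

Lemma window_uniq y z : u y z -> uniq (a :: y ++ v :: rcons z b).
Proof.
move=> uyz; apply: subseq_uniq uyz.
apply: (subseq_trans (prefix_subseq _ B)).
by rewrite cat_cons -catA cat_cons !cat_rcons suffix_subseq.
Qed.

Lemma window_notin y z : u y z ->
  {subset y <= ~: [set x in Z]%SET} /\ {subset z <= ~: [set x in Z]%SET}.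
Proof.
rewrite /u (perm_uniq (perm_window _ _ _ _ _)) cat_uniq => /and3P[_ /hasPn H _].
by split=> x xy; rewrite !inE; apply/negP => /H; rewrite mem_cat xy ?orbT.
Qed.

(** The vertex [v] cuts the second segment into self-avoiding walks from [a] to [v] and from [v] to
    [b], each with [L] vertices outside [Z]. Forgetting that the halves are disjoint turns the sum
    into a product of two [path_sum], with the first segment as the fixed path. *)
Lemma window_pair_bound y z : uniq Z -> u y z -> size y = L -> size z = L ->
  sumseq [set: 'I_n] L (fun y' => sumseq [set: 'I_n] L (fun z' =>
     (u y' z')%:R * p^-1 ^+ #|S y z :&: S y' z'|))
  <= (walk_const r * N%:R ^+ L) ^+ 2.
Proof.
move=> uZ uyz sy sz.
have b1 : 1 <= p^-1 by rewrite invf_ge1.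
set Om := (~: [set x in Z])%SET.
have cOm : #|Om| = N.
  by rewrite cardsCs finset.setCK card_ord cardsE (card_uniqP uZ).
pose gs := a :: y ++ v :: rcons z b.
have ugs : uniq gs by apply: window_uniq.
have cgs : #|[set x in gs]%SET| = (2 * L + 3)%N.
  by rewrite cardsE (card_uniqP ugs) /= size_cat /= size_rcons sy sz; lia.
pose adj x x' := upair x x' \in S y z.
have adjnp x x' : adj x x' -> (x' == next gs x) || (x' == prev gs x).
  exact: walk_edges_next_prev.
have adjgs x x' : adj x x' -> x \in [set x in gs]%SET.
  by rewrite inE; apply: walk_edges_mem.
have psb w x : path_sum p^-1 adj Om w L x <= walk_const r * N%:R ^+ L.
  rewrite -cOm; apply: (@path_sum_bound _ _ _ _ b1 _ _ (prev_next ugs) (next_prev ugs) adjnp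
     _ adjgs Om w r L); rewrite ?cOm ?cgs ?ltr0n //.
have ps0 w x : 0 <= path_sum p^-1 adj Om w L x.
  by apply: sumseq_ge0 => l _ _; apply: path_weight_ge0.
pose F y' z' := path_weight p^-1 adj a (rcons y' v) * path_weight p^-1 adj v (rcons z' b).
have F0 y' z' : 0 <= F y' z' by rewrite mulr_ge0 ?path_weight_ge0.
apply: (@le_trans _ _ (sumseq Om L (fun y' => sumseq Om L (F y')))).
  pose f y' z' : R := (u y' z')%:R * p^-1 ^+ #|S y z :&: S y' z'|.
  have f0 y' z' : 0 <= f y' z' by rewrite mulr_ge0 // exprn_ge0 // (le_trans _ b1).
  have fz y' z' : ~~ (u y' z') -> f y' z' = 0 by rewrite /f => /negPf->; rewrite mul0r.
  rewrite (sumseq_subset (Om := Om)) ?finset.subsetT //; first last.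
  - move=> l nl; rewrite (_ : sumseq _ _ _ = sumseq [set: 'I_n] L (fun l => 0 * 0)).
      by rewrite sumseqZ mul0r.
    apply: eq_sumseq => z' _ _; rewrite mul0r; apply: fz; apply: contra nl.
    by move=> /window_notin[H _]; apply/allP.
  - by move=> l; apply: sumseq_ge0 => z' _ _; apply: f0.
  apply: le_sumseq => y' sy' y'O.
  rewrite (sumseq_subset (Om := Om)) ?finset.subsetT //; first last.
  - move=> z' nz; apply: (fz y' z'); apply: contra nz.
    by move=> /window_notin[_ H]; apply/allP.
  - by move=> z'; apply: f0.
  apply: le_sumseq => z' sz' z'O.
  case: (boolP (u y' z')) => uyz'; last by rewrite mul0r F0.
  rewrite mul1r (le_trans (exp_card_walk_edges _ _ _ b1)) // walk_weight_cat /F.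
  have := window_uniq uyz'; rewrite -cat_rcons -cat_cons cat_uniq => /and3P[u1 _ _].
  have := window_uniq uyz'; rewrite -cat_cons cat_uniq => /and3P[_ _ u2].
  by rewrite /path_weight u1 u2.
rewrite expr2 (le_trans _ (ler_pM (ps0 v a) (ps0 b v) (psb v a) (psb b v))) //.
rewrite {1}/path_sum -sumseqZr; apply: le_sumseq => y' _ _.
by rewrite sumseqZ.
Qed.

End Pair.

Variable Khat : graph n -> {set 'I_n}.

(** The first term is the second-moment price of erasing the hidden edges; the second is the chance
    that [v] is found when they are not planted. *)
Lemma window_bound (A B : seq 'I_n) v delta (N := (n - (size A + size B).+1)%N) :
  (0 < size A)%N -> (0 < size B)%N -> 0 < delta -> (0 < N)%N -> p^-1 <= r * N%:R ->
  4 * L%:R * (2 * L + 3)%:R <= (1 - r) * N%:R -> N%:R * r ^+ L.+1 <= 1 ->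
  (N ^ (L + L) <= 2 * N ^_ (L + L))%N ->
  sumseq [set: 'I_n] (L + L) (fun l =>
    (uniq (A ++ take L l ++ v :: drop L l ++ B))%:R *
    \sum_(G : graph n) ER_prob p G *
      (v \in Khat (G :|: path_graph (A ++ take L l ++ v :: drop L l ++ B)))%:R)
  <= (uniq (A ++ v :: B))%:R *
     (delta * walk_const r ^+ 2 * (N ^_ (L + L))%:R
      + (N ^_ (L + L))%:R / (2 * delta) * \sum_(G : graph n) ER_prob p G *
          (v \in Khat (G :|: (path_graph A :|: path_graph B)))%:R).
Proof.
case/lastP: A @N => // A a N _; case: B @N => // b B N _ d0 N0 pN LN NrL ND.
set Z := rcons A a ++ v :: b :: B.
have NE : N = (n - size Z)%N by rewrite /N /Z size_cat /= !addnS.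
have permZ l : perm_eq (rcons A a ++ take L l ++ v :: drop L l ++ b :: B) (l ++ Z).
  by rewrite (permPl (perm_window _ _ _ _ _)) cat_take_drop.
case: (boolP (uniq Z)) => uZ; last first.
  rewrite mul0r (_ : sumseq _ _ _ = sumseq [set: 'I_n] (L + L) (fun l => 0 * 0)).
    by rewrite sumseqZ mul0r.
  apply: eq_sumseq => l _ _; rewrite (perm_uniq (permZ l)) cat_uniq (negbTE uZ).
  by rewrite !andbF !mul0r.
(* The length is part of [u] because [SC] is asked of every [l] with [u l], while the pair bound
   needs two halves of size [L]. *)
pose u l := (size l == L + L)%N &&
  uniq (rcons A a ++ take L l ++ v :: drop L l ++ b :: B).
pose S l := walk_edges a (take L l ++ v :: rcons (drop L l) b).
pose I G := v \in Khat (G :|: (path_graph (rcons A a) :|: path_graph (b :: B))).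
set D : R := (N ^_ (L + L))%:R.
have D0 : 0 < D.
  rewrite ltr0n -(ltn_pmul2l (ltn0Sn 1)) muln0 (leq_trans _ ND) // expn_gt0 N0 //.
have uD : sumseq [set: 'I_n] (L + L) (fun l => (u l)%:R : R) = D.
  rewrite /D NE -[n in (n - _)%N](card_ord n) -(sumseq_uniq R _ uZ).
  by apply: eq_sumseq => l sl _; rewrite /u sl eqxx (perm_uniq (permZ l)).
have uS l : u l -> S l \subset pairs n.
  by move=> /andP[_ ul]; apply/walk_edges_pairs/window_uniq/ul.
have SC l : u l ->
  sumseq [set: 'I_n] (L + L) (fun l' => (u l')%:R * p^-1 ^+ #|S l :&: S l'|)
  <= 2 * walk_const r ^+ 2 * D.
  move=> /andP[/eqP sl ul].
  have st : size (take L l) = L by rewrite size_takel // sl leq_addr.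
  have sd : size (drop L l) = L by rewrite size_drop sl addnK.
  rewrite NE in N0 pN LN NrL.
  have := window_pair_bound N0 pN LN NrL uZ ul st sd.
  rewrite -NE exprMn -exprM mulnC mul2n -addnn => H.
  rewrite sumseq_cat (le_trans _ (le_trans H _)) //.
    rewrite le_eqVlt; apply/orP; left; apply/eqP.
    apply: eq_sumseq => y' sy' _; apply: eq_sumseq => z' sz' _.
    rewrite /u /S size_cat sy' sz' eqxx /=.
    have -> : take L (y' ++ z') = y' by rewrite -sy' take_size_cat.
    by have -> : drop L (y' ++ z') = z' by rewrite -sy' drop_size_cat.
  (* [ND] replaces the power of [N] by the falling factorial [D], at the cost of a factor 2. *)
  rewrite [leRHS](_ : _ = walk_const r ^+ 2 * (2 * D)); last by ring.
  rewrite ler_wpM2l ?sqr_ge0 //.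
  by rewrite /D -natrX -natrM ler_nat.
have := planting_second_moment p0 p1 I D0 d0 uS uD SC.
rewrite mul1r (_ : delta / 2 * (2 * walk_const r ^+ 2) = delta * walk_const r ^+ 2); last by field.
apply: le_trans; rewrite le_eqVlt; apply/orP; left; apply/eqP.
apply: eq_sumseq => l sl _; rewrite /u sl eqxx /=; congr (_ * _).
apply: eq_bigr => G _; rewrite /I path_graph_window -/(S l).
by rewrite [_ :|: S l]finset.setUC finset.setUA.
Qed.

End Window.

Lemma ffact_add n i j : (n ^_ (i + j) = n ^_ i * (n - i) ^_ j)%N.
Proof.
elim: j => [|j IH]; first by rewrite addn0 ffactn0 muln1.
by rewrite addnS !ffactnSr IH subnDA mulnA.
Qed.

(** Cutting the path into sizes [c], [L], 1, [L], [d] and summing the hidden entries innermost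
    leaves [A], [v] and [B] fixed, as [window_bound] requires. *)
Lemma sumseq_window (R : numDomainType) (T : finType) (Om : {set T}) c L d (phi : seq T -> R) :
  sumseq Om (c + (L + (1 + (L + d)))) phi
  = sumseq Om c (fun A => sumseq Om d (fun B => \sum_(v in Om)
      sumseq Om (L + L) (fun l => phi (A ++ take L l ++ v :: drop L l ++ B)))).
Proof.
rewrite sumseq_cat; apply: eq_sumseq => A _ _.
rewrite sumseq_cat [RHS]sumseq_sum.
under eq_sumseq => y _ _ do rewrite add1n /=.
rewrite sumseq_sum; apply: eq_bigr => v _.
transitivity (sumseq Om L (fun y => sumseq Om d (fun B => sumseq Om L (fun z =>
   phi (A ++ y ++ v :: z ++ B))))).
  by apply: eq_sumseq => y _ _; rewrite sumseq_cat exchange_sumseq.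
rewrite exchange_sumseq; apply: eq_sumseq => B _ _.
rewrite sumseq_cat; apply: eq_sumseq => y sy _; apply: eq_sumseq => z _ _.
by rewrite -{1}sy take_size_cat // -{1}sy drop_size_cat.
Qed.

(** * Probability of finding one interior position *)

Section Position.
Variables (R : realType) (n : nat) (p r : R) (L K : nat) (delta : R).
Hypotheses (p0 : 0 < p) (p1 : p <= 1) (r0 : 0 < r) (r1 : r < 1) (delta0 : 0 < delta).
Variable Khat : graph n -> {set 'I_n}.
Hypothesis KhatE : forall G, #|Khat G| = K.
Hypothesis (Kn : (K <= n)%N).
Let N := (n - K + (L + L))%N.
Hypotheses (N0 : (0 < N)%N) (pN : p^-1 <= r * N%:R).
Hypothesis LN : 4 * L%:R * (2 * L + 3)%:R <= (1 - r) * N%:R.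
Hypothesis NrL : N%:R * r ^+ L.+1 <= 1.
Hypothesis ND : (N ^ (L + L) <= 2 * N ^_ (L + L))%N.

Lemma position_bound (x0 : 'I_n) c d :
  (0 < c)%N -> (0 < d)%N -> K = (c + (L + (1 + (L + d))))%N ->
  sumseq [set: 'I_n] K (fun l => (uniq l)%:R *
     \sum_(G : graph n) ER_prob p G * (nth x0 l (c + L) \in Khat (G :|: path_graph l))%:R)
  <= (delta * walk_const r ^+ 2 + K%:R / (2 * delta * (n - K).+1%:R)) * (n ^_ K)%:R.
Proof.
move=> c0 d0 KE; rewrite {1}KE sumseq_window.
pose q := (c + d)%N.
have NE : N = (n - q.+1)%N by rewrite /N /q; lia.
set D : R := (N ^_ (L + L))%:R.
pose E A B v : R := \sum_(G : graph n) ER_prob p G *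
          (v \in Khat (G :|: (path_graph A :|: path_graph B)))%:R.
have H1 : sumseq [set: 'I_n] c (fun A => sumseq [set: 'I_n] d (fun B =>
   \sum_(v in [set: 'I_n]) (uniq (A ++ v :: B))%:R)) = (n ^_ q.+1)%:R :> R.
  rewrite -[n in RHS](card_ord n) -[#|_|]subn0 -(sumseq_uniq R (Z := [::])) //.
  rewrite /q -addnS sumseq_cat; apply: eq_sumseq => A _ _.
  by rewrite sumseq_sum; apply: eq_bigr => v _; apply: eq_sumseq => B _ _; rewrite cats0.
have H2 : sumseq [set: 'I_n] c (fun A => sumseq [set: 'I_n] d (fun B =>
   \sum_(v in [set: 'I_n]) (uniq (A ++ v :: B))%:R * E A B v)) <= K%:R * (n ^_ q)%:R :> R.
  rewrite -[n in leRHS](card_ord n) -[#|_|]subn0 -(sumseq_uniq R (Z := [::])) //.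
  rewrite /q sumseq_cat -sumseqZ; apply: le_sumseq => A _ _.
  rewrite -sumseqZ; apply: le_sumseq => B _ _; rewrite cats0.
  (* Relaxing uniqueness to [A ++ B] frees [v]; the sum over [v] then counts the [K] elements of an
     estimated set that does not depend on [v]. *)
  apply: (@le_trans _ _ (\sum_(v in [set: 'I_n]) (uniq (A ++ B))%:R * E A B v)).
    apply: ler_sum => v _; apply: ler_wpM2r.
      by apply: sumr_ge0 => G _; rewrite mulr_ge0 ?ER_prob_ge0.
    rewrite ler_nat; case: (boolP (uniq (A ++ v :: B))) => // uAB.
    by rewrite (subseq_uniq _ uAB) // cat_subseq // subseq_cons.
  rewrite -mulr_sumr mulrC ler_wpM2r // /E exchange_big /=.
  rewrite -[leRHS]mulr1 -[X in _ <= _ * X](sum_ER_prob n p) mulr_sumr; apply: ler_sum => G _.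
  rewrite -mulr_sumr mulrC ler_wpM2r ?ER_prob_ge0 //.
  rewrite -(KhatE (G :|: (path_graph A :|: path_graph B))); set X := Khat _.
  have -> : #|X|%:R = \sum_(v in X) 1 :> R by rewrite sumr_const.
  rewrite [leLHS]big_mkcond [leRHS]big_mkcond /=; apply: ler_sum => v _.
  by rewrite inE; case: (_ \in _).
apply: (@le_trans _ _ (sumseq [set: 'I_n] c (fun A => sumseq [set: 'I_n] d (fun B =>
   \sum_(v in [set: 'I_n]) (uniq (A ++ v :: B))%:R *
     (delta * walk_const r ^+ 2 * D + D / (2 * delta) * E A B v))))).
  apply: le_sumseq => A sA _; apply: le_sumseq => B sB _; apply: ler_sum => v _.
  have NAB : N = (n - (size A + size B).+1)%N by rewrite NE sA sB.
  move: N0 pN LN NrL ND; rewrite NAB => N0' pN' LN' NrL' ND'.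
  have A0 : (0 < size A)%N by rewrite sA.
  have B0 : (0 < size B)%N by rewrite sB.
  have := window_bound p0 p1 r0 r1 Khat v A0 B0 delta0 N0' pN' LN' NrL' ND'.
  rewrite -NAB -/D -/(E A B v); apply: le_trans.
  rewrite le_eqVlt; apply/orP; left; apply/eqP; apply: eq_sumseq => l sl _.
  have -> // : nth x0 (A ++ take L l ++ v :: drop L l ++ B) (c + L) = v.
  rewrite nth_cat sA ltnNge leq_addr /= addKn nth_cat size_takel ?sl ?leq_addr //.
  by rewrite ltnn subnn.
have -> : (n ^_ K)%:R = (n ^_ q.+1)%:R * D :> R.
  rewrite KE (_ : (c + _ = q.+1 + (L + L))%N); last by rewrite /q; lia.
  by rewrite ffact_add natrM /D NE.
apply: (@le_trans _ _ (delta * walk_const r ^+ 2 * D * (n ^_ q.+1)%:R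
   + D / (2 * delta) * (K%:R * (n ^_ q)%:R))).
  rewrite -H1 (le_trans _ (lerD (lexx _) (ler_wpM2l _ H2))) //; last first.
    by rewrite divr_ge0 // mulr_ge0 // ltW.
  rewrite -!sumseqZ -sumseqD; apply: le_sumseq => A _ _.
  rewrite -!sumseqZ -sumseqD; apply: le_sumseq => B _ _.
  rewrite !mulr_sumr -big_split /=; apply: ler_sum => v _.
  by rewrite le_eqVlt; apply/orP; left; apply/eqP; ring.
rewrite [leRHS]mulrDl lerD //; first by rewrite le_eqVlt; apply/orP; left; apply/eqP; ring.
rewrite ffactnSr natrM.
have nq : (n - K).+1%:R <= (n - q)%:R :> R by rewrite ler_nat /q; lia.
have nK0 : (0 : R) < (n - K).+1%:R by [].
rewrite [leLHS](_ : _ = K%:R / (2 * delta * (n - K).+1%:R) * ((n ^_ q)%:R * (n - K).+1%:R * D)).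
  by rewrite ler_wpM2l ?divr_ge0 ?mulr_ge0 ?(ltW delta0) // ler_wpM2r // ler_wpM2l.
by field; rewrite !gt_eqF.
Qed.
End Position.

(** * The overlap *)

Lemma sum_tuple_sumseq (R : numDomainType) (T : finType) K (phi : seq T -> R) :
  \sum_(t : K.-tuple T) phi t = sumseq [set: T] K phi.
Proof.
elim: K phi => [|K IH] phi.
  by rewrite (big_pred1 [tuple]) // => t; apply/esym/eqP; rewrite [t]tuple0.
rewrite (reindex (fun xt : T * K.-tuple T => [tuple of xt.1 :: xt.2])) /=; last first.
  exists (fun t : K.+1.-tuple T => (thead t, [tuple of behead t])).
    by move=> [x t] _; rewrite /= theadE; congr (_, _); apply: val_inj.
  by move=> t _; rewrite [RHS]tuple_eta.
rewrite -(pair_bigA _ (fun x (t : K.-tuple T) => phi (x :: t))) /=.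
by apply: eq_big => [x|x _]; [rewrite inE | exact: (IH (fun l => phi (x :: l)))].
Qed.

Lemma sum_ffun_sumseq (R : numDomainType) (T : finType) K (phi : seq T -> R) :
  \sum_(s : {ffun 'I_K -> T}) phi (map s (enum 'I_K)) = sumseq [set: T] K phi.
Proof.
rewrite -sum_tuple_sumseq.
rewrite (reindex (fun t : K.-tuple T => [ffun i => tnth t i])) /=; last first.
  exists (fun s : {ffun 'I_K -> T} => [tuple s i | i < K]).
    by move=> t _; apply: eq_from_tnth => i; rewrite tnth_mktuple ffunE.
  by move=> s _; apply/ffunP => i; rewrite ffunE tnth_mktuple.
apply: eq_bigr => t _; congr phi.
by rewrite -[RHS](map_tnth_enum t); apply: eq_map => i; rewrite ffunE.
Qed.

Lemma walk_edges_nthP n (x0 x : 'I_n) l e :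
  reflect (exists2 i, (i < size l)%N & e = upair (nth x0 (x :: l) i) (nth x0 l i))
          (e \in walk_edges x l).
Proof.
elim: l x => [|y l IH] x /=; first by rewrite inE; constructor=> -[].
rewrite !inE; apply: (iffP orP) => [[/eqP eE|/IH[i il eE]]|[[|i] il eE]].
- by exists 0%N.
- by exists i.+1.
- by left; apply/eqP.
- by right; apply/IH; exists i.
Qed.

Lemma path_edgesE n K (s : {ffun 'I_K -> 'I_n}) :
  path_edges s = path_graph (map s (enum 'I_K)).
Proof.
case: K s => [|K] s.
  rewrite (_ : enum 'I_0 = [::]) /=; last by apply: size0nil; rewrite size_enum_ord.
  by apply/setP => e; rewrite inE; apply/imsetP => -[[[]]].
have sz : size (map s (enum 'I_K.+1)) = K.+1 by rewrite size_map size_enum_ord.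
have nthE i (iK : (i < K.+1)%N) :
    nth (s ord0) (map s (enum 'I_K.+1)) i = s (Ordinal iK).
  rewrite (nth_map ord0) ?size_enum_ord //; congr (s _).
  by apply: val_inj; rewrite /= nth_enum_ord.
case E : (map s (enum 'I_K.+1)) sz nthE => [//|x l] /= [sl] nthE.
apply/setP => e; apply/imsetP/(walk_edges_nthP (s ord0)).
  move=> [[[i iK] [j jK]]]; rewrite inE /= => /eqP ji ->; subst j.
  by exists i; rewrite ?sl // -(nthE i iK) -(nthE i.+1 jK).
move=> [i il ->]; rewrite sl in il.
have iK : (i < K.+1)%N by apply: leq_trans il _.
have jK : (i.+1 < K.+1)%N by [].
exists (Ordinal iK, Ordinal jK); first by rewrite inE.
by rewrite /= -(nthE i iK) -(nthE i.+1 jK).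
Qed.

Lemma sum_ltn_le j m : (\sum_(k < j) (k < m) <= m)%N.
Proof.
elim: j => [|j IH]; first by rewrite big_ord0.
rewrite big_ord_recr /=; case: ltnP => jm; last by rewrite addn0.
rewrite addn1 (leq_ltn_trans _ jm) //.
by rewrite -[leqRHS]card_ord -sum1_card leq_sum // => i _; apply: leq_b1.
Qed.

Section Overlap.
Variables (R : realType) (n : nat) (lam : R) (K : nat).
Let p := edge_p lam n.
Hypotheses (p0 : 0 < p) (Kn : (K <= n)%N).
Variable Khat : graph n -> {set 'I_n}.

(** Divided by [n ^_ K], the number of injections, this is the probability that the vertex at
    position [k] is in the estimated set. *)
Let hit x0 k : R := sumseq [set: 'I_n] K (fun l => (uniq l)%:R *
  \sum_(G : graph n) ER_prob p G * (nth x0 l k \in Khat (G :|: path_graph l))%:R).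

Lemma edge_p_le1 : p <= 1.
Proof. by rewrite /p /edge_p ge_min lexx. Qed.

Lemma ffactK_gt0 : (0 : R) < (n ^_ K)%:R.
Proof. by rewrite ltr0n ffact_gt0. Qed.

Lemma hit_le x0 k : hit x0 k <= (n ^_ K)%:R.
Proof.
rewrite -[n in leRHS](card_ord n) -[#|_|]subn0 -(sumseq_uniq R (Z := [::])) //.
apply: le_sumseq => l _ _; rewrite cats0 ler_piMr //.
rewrite -[leRHS](sum_ER_prob n p); apply: ler_sum => G _.
by rewrite ler_piMr ?ER_prob_ge0 ?edge_p_le1 // lern1 leq_b1.
Qed.

(** A found planted vertex is [s k] for some position [k], so positions can be counted instead of
    vertices. *)
Lemma overlap_le x0 :
  overlap lam K Khat <= \sum_(k < K) hit x0 k / (n ^_ K)%:R.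
Proof.
have cinj : #|injs n K| = (n ^_ K)%N by rewrite card_inj_ffuns !card_ord.
rewrite -mulr_suml /hit -sumseq_sum -sum_ffun_sumseq mulr_suml.
rewrite /overlap exchange_big /= big_mkcond /=; apply: ler_sum => s _.
rewrite inE cinj; case: ifP => [si|_]; last first.
  rewrite mulr_ge0 ?invr_ge0 // sumr_ge0 // => k _; rewrite mulr_ge0 // sumr_ge0 // => G _.
  by rewrite mulr_ge0 ?ER_prob_ge0 ?edge_p_le1.
have -> : uniq (map s (enum 'I_K)) = true by [].
rewrite exchange_big /=; under [X in _ <= X / _]eq_bigr do rewrite mul1r.
rewrite [X in _ <= X / _]exchange_big mulr_suml /=; apply: ler_sum => G _.
rewrite -!mulr_sumr mulrAC ler_wpM2r ?invr_ge0 // ler_wpM2l ?ER_prob_ge0 ?edge_p_le1 //.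
rewrite path_edgesE; set X := Khat _.
apply: (@le_trans _ _ (\sum_(i : 'I_n) \sum_(k < K) (i \in X)%:R * (i == s k)%:R)).
  apply: ler_sum => i _; case: (boolP (i \in X)) => iX /=; last first.
    by rewrite sumr_ge0 // => k _; rewrite mul0r.
  case: imsetP => [[k _ ->]|_]; last by rewrite sumr_ge0 // => k _; rewrite mul1r.
  rewrite (bigD1 k) //= eqxx mulr1 lerDl sumr_ge0 // => j _.
rewrite exchange_big; apply: ler_sum => k _.
rewrite (bigD1 (s k)) //= eqxx mulr1 big1 ?addr0; last by move=> i /negPf->; rewrite mulr0.
by rewrite (nth_map k) ?size_enum_ord // nth_ord_enum.
Qed.

Lemma overlap_bound (r delta : R) L (N := (n - K + (L + L))%N) :
  0 < r -> r < 1 -> 0 < delta -> (forall G, #|Khat G| = K) ->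
  (0 < N)%N -> p^-1 <= r * N%:R ->
  4 * L%:R * (2 * L + 3)%:R <= (1 - r) * N%:R -> N%:R * r ^+ L.+1 <= 1 ->
  (N ^ (L + L) <= 2 * N ^_ (L + L))%N ->
  overlap lam K Khat <=
    2 * L.+1%:R + K%:R * (delta * walk_const r ^+ 2 + K%:R / (2 * delta * (n - K).+1%:R)).
Proof.
move=> r0 r1 d0 KE N0 pN LN NrL ND.
have [->|K0] := posnP K.
  rewrite mul0r addr0 /overlap big1 ?mulr_ge0 // => i _; rewrite big1 // => s _.
  rewrite big1 // => G _.
  by case: (boolP (i \in planted s)) => [/imsetP[[]]//|_]; rewrite andbF mulr0.
have n0 : (0 < n)%N by apply: leq_trans Kn.
pose x0 : 'I_n := Ordinal n0.
rewrite (le_trans (overlap_le x0)) //.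
set eps := delta * _ + _.
have eps0 : 0 <= eps.
  rewrite addr_ge0 //; first by rewrite mulr_ge0 ?sqr_ge0 ?(ltW d0).
  by rewrite divr_ge0 // mulr_ge0 // mulr_ge0 // (ltW d0).
(* Positions with at most [L] path vertices on one side get the trivial bound 1. Elsewhere both
   revealed pieces are nonempty and supply the ends of the hidden segment. *)
apply: (@le_trans _ _ (\sum_(k < K) (((k < L.+1)%N + (K - k.+1 < L.+1)%N)%:R + eps))).
  apply: ler_sum => k _.
  have [kL|Lk] := leqP k L.
    rewrite (le_trans (y := 1)) // ?ler_pdivrMr ?ffactK_gt0 ?mul1r ?hit_le //.
    by rewrite -[leLHS]addr0 lerD // ler1n !ltnS kL.
  have [kL|Lk'] := leqP (K - k.+1) L.
    rewrite (le_trans (y := 1)) // ?ler_pdivrMr ?ffactK_gt0 ?mul1r ?hit_le //.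
    by rewrite -[leLHS]addr0 lerD // ler1n !ltnS kL addn1.
  rewrite !ltnS leqNgt Lk leqNgt Lk' add0r ler_pdivrMr ?ffactK_gt0 //.
  have kK := ltn_ord k.
  have kE : (k - L + L)%N = k by rewrite subnK // ltnW.
  have := position_bound p0 edge_p_le1 r0 r1 d0 KE Kn N0 pN LN NrL ND x0
     (c := (k - L)%N) (d := (K - k.+1 - L)%N).
  by rewrite kE; apply; lia.
rewrite big_split /= sumr_const card_ord [K%:R * _]mulr_natl lerD2r -natr_sum big_split /=.
rewrite -natrM ler_nat mul2n -addnn leq_add ?sum_ltn_le //.
rewrite (reindex_inj rev_ord_inj) /= (leq_trans _ (sum_ltn_le K L.+1)) //.
apply: leq_sum => k _.
by have -> : (K - (K - k.+1).+1 = k)%N by have := ltn_ord k; lia.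
Qed.

End Overlap.

(** * Asymptotics *)

(** This is [N ^_ m >= N ^ m * (1 - m ^ 2 / N)], written without division or truncated
    subtraction. *)
Lemma ffact_lower_bound N m : (N ^ m * N <= N ^_ m * N + m ^ 2 * N ^ m)%N.
Proof.
elim: m => [|m IH]; first by rewrite expn0 ffactn0; lia.
have [Nm|mN] := leqP N m.
  rewrite (leq_trans _ (leq_addl _ _)) // mulnC leq_mul2r; apply/orP; right.
  by rewrite (leq_trans Nm) // (leq_trans (leqnSn m)) // -mulnn leq_pmulr.
rewrite ffactnSr expnS.
have := leq_mul IH (leqnn (N - m)).
have [k ->] : exists k, N = (m + k)%N by exists (N - m)%N; lia.
rewrite addKn; move: (_ ^ m)%N (_ ^_ m)%N => a b; rewrite -!mulnn; nia.
Qed.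

Lemma ffact_ge_half_exp N m : (0 < N)%N -> (2 * m ^ 2 <= N)%N -> (N ^ m <= 2 * N ^_ m)%N.
Proof.
move=> N0 mN; rewrite -(leq_pmul2r N0).
have := ffact_lower_bound N m; have := leq_mul mN (leqnn (N ^ m)).
move: (N ^ m)%N (N ^_ m)%N (m ^ 2)%N => a b c; nia.
Qed.

Lemma cube_le_exp2 t : (t.+1 ^ 3 <= 8 * 2 ^ t)%N.
Proof.
elim: t => // t IH; rewrite [(2 ^ t.+1)%N]expnS.
have [t3|t3] := leqP t 2; first by move: t t3 {IH} => [|[|[|]]].
apply: (@leq_trans (2 * t.+1 ^ 3)); last by rewrite mulnCA leq_mul2l.
rewrite !expnS expn0; nia.
Qed.

Local Open Scope classical_set_scope.
Local Open Scope ring_scope.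

Lemma near_log_square_le {R : realType} (c : nat) (kappa : R) : 0 < kappa ->
  \forall n \near \oo, ((c * (trunc_log 2 n).+1) ^ 2)%:R <= kappa * n%:R.
Proof.
(* With [t] the logarithm of [n], [cube_le_exp2] gives [c ^ 2 * (t + 1) ^ 3 <= 8 * c ^ 2 * n]; it
   suffices that [kappa * (t + 1)] exceeds [8 * c ^ 2], which [b <= t] ensures. *)
move=> k0; pose b := Num.bound (8 * (c ^ 2)%:R / kappa).
exists (2 ^ b)%N => // n /= bn; set t := trunc_log 2 n.
have n0 : (0 < n)%N by apply: leq_trans bn; rewrite expn_gt0.
have bt : (b <= t)%N by apply: trunc_log_max.
have tn : (2 ^ t <= n)%N by apply: trunc_logP.
have cb : 8 * (c ^ 2)%:R <= kappa * t.+1%:R.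
  rewrite [leRHS]mulrC -ler_pdivrMr //.
  have x0 : 0 <= 8 * (c ^ 2)%:R / kappa by rewrite divr_ge0 ?(ltW k0) ?mulr_ge0.
  by rewrite (le_trans (ltW (archi_boundP x0))) // ler_nat leqW.
have H3 : (t.+1 ^ 3)%:R <= (8 * n)%:R :> R.
  by rewrite ler_nat (leq_trans (cube_le_exp2 t)) // leq_mul2l.
have t0 : (0 : R) < t.+1%:R by [].
rewrite -(ler_pM2r t0) expnMn natrM -mulrA -natrM -expnSr.
rewrite (le_trans (ler_wpM2l _ H3)) // natrM mulrA [_ * 8]mulrC.
by rewrite [leRHS]mulrAC ler_wpM2r.
Qed.

Theorem theorem7 (R : realType) (lam : R) (K : nat -> nat)
  (Khat : forall n : nat, graph n -> {set 'I_n}) :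
  1 < lam ->
  (* K = omega(sqrt n) *)
  (forall M : R, \forall n \near \oo, M <= (K n)%:R / Num.sqrt (n%:R)) ->
  (* K = o(n) *)
  ((fun n : nat => (K n)%:R / (n%:R : R)) @ \oo --> 0%R) ->
  (* each Khat n is an estimator: a set of K n nodes computed from G *)
  (forall n (G : graph n), #|Khat n G| = K n) ->
  (* ov(Khat) = o(K) *)
  ((fun n : nat => overlap lam (K n) (Khat n) / (K n)%:R) @ \oo --> 0%R).
Proof.
move=> lam1 Kbig Ksmall KhatE; apply/cvgr0Pnorm_le => eps eps0.
(* The midpoint of [1 / lam] and 1: the gap below absorbs the passage from [n] to [N], the gap above
   makes the geometric series converge. *)
pose r : R := (1 + lam^-1) / 2.
have lam0 : 0 < lam by apply: lt_trans lam1.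
have li0 : 0 < lam^-1 by rewrite invr_gt0.
have li1 : lam^-1 < 1 by rewrite invf_lt1.
have r0 : 0 < r by rewrite /r; lra.
have r1 : r < 1 by rewrite /r; lra.
have lr : lam^-1 < r by rewrite /r; lra.
have W0 := walk_const_gt0 r1; set W := walk_const r in W0.
(* Error budget: [eps / 4] from the second moment, [eps / 4] from the term in [K / (n - K + 1)], and
   [eps / 2] from the positions near the ends. *)
pose delta := eps / (4 * W ^+ 2).
have W20 : 0 < W ^+ 2 by rewrite exprn_gt0.
have delta0 : 0 < delta by rewrite divr_gt0 // mulr_gt0.
have deltaW : delta * W ^+ 2 = eps / 4.
  by rewrite /delta; field; rewrite gt_eqF.
(* Bounds for [K / n], in order: [N] is at least [n / 2]; the term in [K / (n - K + 1)] is at most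
   [eps / 4]; and [n / lam <= r * (n - K)]. *)
pose eta := Num.min (1 / 2) (Num.min (eps * delta / 4) (1 - lam^-1 / r)).
have eta0 : 0 < eta.
  rewrite !lt_min; apply/and3P; split; first lra.
    by rewrite divr_gt0 // mulr_gt0.
  by rewrite subr_gt0 ltr_pdivrMr // mul1r.
(* Bounds for [(L + 1) / K], in order: the end positions cost at most [eps / 2]; the segment fits in
   the path; and the conditions quadratic in [L] hold. *)
pose kappa := Num.min (eps / 4) (Num.min (1 / 2) ((1 - r) / 24)).
have kappa0 : 0 < kappa.
  by rewrite !lt_min; apply/and3P; split; try lra.
(* With [L + 1] equal to [c] times [trunc_log 2 n + 1], the power [r ^+ L.+1] falls below
   [1 / n]. *)
have [c c0 rc] : exists2 c, (0 < c)%N & r ^+ c <= 1 / 2.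
  have /cvgr0Pnorm_le/(_ (1 / 2)) : (fun n : nat => r ^+ n) @ \oo --> 0%R.
    by apply: cvg_expr; rewrite ger0_norm // ltW.
  case=> [|c _ Hc]; first lra.
  exists c.+1 => //; have := Hc c.+1 (leqnSn c).
  by rewrite /= ger0_norm // exprn_ge0 // ltW.
have Lsmall := near_log_square_le c (exprn_gt0 2 kappa0).
near=> n.
have n0 : (0 < n)%N by near: n; exists 1%N.
have nlam : lam <= n%:R by near: n; apply: nbhs_infty_ger.
have KS : (K n)%:R <= eta * n%:R :> R.
  rewrite -ler_pdivrMr ?ltr0n // (le_trans (ler_norm _)) //; near: n.
  by move: eta eta0 => e e0; move/cvgr0Pnorm_le: Ksmall; apply.
have K1 : Num.sqrt n%:R <= (K n)%:R :> R.
  rewrite -[leLHS]mul1r -ler_pdivlMr ?sqrtr_gt0 ?ltr0n //; near: n; exact: Kbig.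
have Mn : ((c * (trunc_log 2 n).+1) ^ 2)%:R <= kappa ^+ 2 * n%:R by near: n.
set M := (c * (trunc_log 2 n).+1)%N in Mn.
have M0 : (0 < M)%N by rewrite muln_gt0 c0.
have nR : (0 : R) < n%:R by rewrite ltr0n.
have etaE : [/\ eta <= 1 / 2, eta <= eps * delta / 4 & eta <= 1 - lam^-1 / r].
  by split; rewrite /eta !ge_min lexx ?orbT.
have kappaE : [/\ kappa <= eps / 4, kappa <= 1 / 2 & kappa <= (1 - r) / 24].
  by split; rewrite /kappa !ge_min lexx ?orbT.
case: etaE kappaE => eta1 eta2 eta3 [kappa1 kappa2 kappa3].
have kappa_sqr : kappa ^+ 2 <= (1 - r) / 24.
  by rewrite (le_trans _ kappa3) // expr2 ler_piMr ?ltW //; lra.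
(* The lower bound on [K] enters here: [M ^ 2 <= kappa ^ 2 * n] and [n <= K ^ 2]. *)
have MK : M%:R <= kappa * (K n)%:R :> R.
  have nK : n%:R <= (K n)%:R ^+ 2 :> R.
    by rewrite -[leLHS]sqr_sqrtr // lerXn2r ?nnegrE ?sqrtr_ge0.
  rewrite -(@ler_pXn2r _ 2) ?nnegrE ?mulr_ge0 ?(ltW kappa0) // -natrX exprMn.
  by rewrite (le_trans Mn) // ler_wpM2l // sqr_ge0.
have K0 : (0 : R) < (K n)%:R by rewrite (lt_le_trans _ K1) // sqrtr_gt0.
have Kn2 : (K n)%:R <= n%:R / 2 :> R.
  by rewrite (le_trans KS) // mulrC ler_wpM2l // -div1r.
have Kn : (K n <= n)%N by rewrite -(ler_nat R); lra.
pose L := M.-1; have ML : M = L.+1 by rewrite prednK.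
pose N := (n - K n + (L + L))%N.
have LK : (L + L <= K n)%N.
  rewrite -(ler_nat R) natrD.
  have LM : L%:R <= M%:R :> R by rewrite ler_nat leq_pred.
  have := ler_wpM2r (ltW K0) kappa2; lra.
have Nn : N%:R <= n%:R :> R by rewrite ler_nat /N -[leqRHS](subnK Kn) leq_add2l.
have NKn : n%:R - (K n)%:R <= N%:R :> R by rewrite -natrB // ler_nat leq_addr.
have N2 : n%:R / 2 <= N%:R :> R by lra.
have N0 : (0 < N)%N by rewrite -(ltr0n R); lra.
have pE : edge_p lam n = lam / n%:R.
  by rewrite /edge_p min_r // ler_pdivrMr // mul1r.
have p0 : 0 < edge_p lam n by rewrite pE divr_gt0.
have pN : (edge_p lam n)^-1 <= r * N%:R.
  have re : r * eta <= r - lam^-1.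
    rewrite (le_trans (ler_wpM2l (ltW r0) eta3)) // mulrBr mulr1 mulrCA divff ?mulr1 //.
    by rewrite gt_eqF.
  rewrite pE invf_div mulrC.
  have := ler_wpM2l (ltW r0) NKn; have := ler_wpM2l (ltW r0) KS.
  have := ler_wpM2r (ltW nR) re; lra.
have M24 : 24 * (M ^ 2)%:R <= (1 - r) * n%:R :> R.
  have := ler_wpM2r (ltW nR) kappa_sqr; lra.
have rN : (1 - r) * (n%:R / 2) <= (1 - r) * N%:R by rewrite ler_wpM2l // subr_ge0 ltW.
have LN : 4 * L%:R * (2 * L + 3)%:R <= (1 - r) * N%:R.
  have : (4 * L * (2 * L + 3))%:R <= (12 * M ^ 2)%:R :> R.
    by rewrite ler_nat ML -mulnn; move: (L) => l; clear; nia.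
  rewrite (natrM _ 12) (natrM _ (4 * L)) (natrM _ 4); lra.
have NrL : N%:R * r ^+ L.+1 <= 1.
  rewrite -ML /M exprM (le_trans (y := n%:R * (1 / 2) ^+ (trunc_log 2 n).+1)) //.
    apply: ler_pM; rewrite ?exprn_ge0 ?(ltW r0) //.
    by rewrite lerXn2r ?nnegrE ?exprn_ge0 ?(ltW r0).
  rewrite div1r exprVn ler_pdivrMr ?exprn_gt0 // mul1r -natrX ler_nat ltnW //.
  exact: trunc_log_ltn.
have ND : (N ^ (L + L) <= 2 * N ^_ (L + L))%N.
  apply: ffact_ge_half_exp => //; rewrite -(ler_nat R) (le_trans _ N2) //.
  have : (2 * (L + L) ^ 2)%:R <= (8 * M ^ 2)%:R :> R by rewrite ler_nat ML -!mulnn; move: (L) => l; clear; nia.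
  have : (1 - r) * n%:R <= n%:R by rewrite ler_piMl ?ltW //; lra.
  rewrite (natrM _ 8); lra.
have := overlap_bound p0 Kn r0 r1 delta0 (KhatE n) N0 pN LN NrL ND.
rewrite -/W deltaW -ML => ov.
have Kd : (K n)%:R / (2 * delta * (n - K n).+1%:R) <= eps / 4.
  have nK : (n - K n).+1%:R = n%:R - (K n)%:R + 1 :> R by rewrite -natr1 natrB.
  have d0 : 0 < 2 * delta * (n - K n).+1%:R by apply: mulr_gt0 => //; apply: mulr_gt0.
  rewrite ler_pdivrMr // nK.
  have ed : 0 < eps * delta by rewrite mulr_gt0.
  have H1 : (K n)%:R <= eps * delta / 4 * n%:R.
    by rewrite (le_trans KS) // ler_wpM2r.
  have H2 : eps * delta * (n%:R / 2) <= eps * delta * (n%:R - (K n)%:R + 1).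
    by rewrite ler_wpM2l ?(ltW ed) //; lra.
  lra.
rewrite ger0_norm; last first.
  rewrite divr_ge0 // sumr_ge0 // => i _; rewrite sumr_ge0 // => s _.
  rewrite sumr_ge0 // => G _; rewrite mulr_ge0 // divr_ge0 // ER_prob_ge0 //.
  exact: edge_p_le1.
rewrite ler_pdivrMr // (le_trans ov) //.
have := ler_wpM2l (ltW K0) Kd; have := ler_wpM2r (ltW K0) kappa1.
move: MK; set q := _ / (2 * delta * _); set k := (K n)%:R; set m := M%:R.
lra.
Unshelve. all: by end_near.
Qed.
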